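(* Let $\mathsf{C}$ be a positive and $\sigma$-continuous quasi-Markov category with countable Kolmogorov products. Then the infinite parallel composite construction, sending a sequence of objects $(X_i)_{i\in\mathbb{N}}$ to $\bigotimes_{i\in\mathbb{N}}X_i$ and a sequence of morphisms $(f_i:X_i\to Y_i)_{i\in\mathbb{N}}$ to $f_1^{\mathbb{N}}:\bigotimes_{i\in\mathbb{N}}X_i\to\bigotimes_{i\in\mathbb{N}}Y_i$, defines a functor $\mathsf{C}^{\mathbb{N}}\to\mathsf{C}$.
   Context: Notation: $\mathbb{N}=\{1,2,3,\ldots\}$; composition is written by juxtaposition; coherence isomorphisms are suppressed. $\mathsf{C}^{\mathbb{N}}$ is the category of sequences of objects and sequences of morphisms of $\mathsf{C}$ (countable power of $\mathsf{C}$). A CD category is a symmetric monoidal category $(\mathsf{C},\otimes,I)$ in which every object $X$ carries a distinguished commutative comonoid structure $\mathrm{copy}_X:X\to X\otimes X$, $\mathrm{del}_X:X\to I$, compatible with the tensor product (these are not required to be natural). A morphism $f:A\to X$ is total if $\mathrm{del}_X f=\mathrm{del}_A$; quasi-total if $f=(f\otimes \mathrm{del}_X f)\,\mathrm{copy}_A$; copyable if $\mathrm{copy}_X f=(f\otimes f)\,\mathrm{copy}_A$; deterministic if total and copyable. A quasi-Markov category is a CD category in which every morphism is quasi-total. $\mathsf{C}$ is positive if for all $f:X\to Y$, $g:Y\to Z$ with $gf$ copyable one has $(\mathrm{id}_Y\otimes g)\,\mathrm{copy}_Y f=(f\otimes gf)\,\mathrm{copy}_X$. The domain of $f:A\to X$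 is $\mathrm{dom}(f)=(\mathrm{id}_A\otimes \mathrm{del}_X f)\,\mathrm{copy}_A:A\to A$. For $f,g:A\to X$, write $f\sqsupseteq g$ ($f$ extends $g$) if $f\,\mathrm{dom}(g)=g$; this is a partial order on hom-sets. A positive quasi-Markov category is $\sigma$-continuous if, with respect to $\sqsupseteq$, every descending sequence $f_1\sqsupseteq f_2\sqsupseteq\cdots$ of morphisms $X\to Y$ has a meet (greatest lower bound) $\bigwedge_n f_n$, and these meets are preserved by pre- and post-composition and by tensoring with arbitrary morphisms. A Kolmogorov product $\bigotimes_{i\in\mathbb{N}}X_i$ of a sequence of objects is a limit in $\mathsf{C}$ of the diagram $\cdots\to X_1\otimes\cdots\otimes X_n\to\cdots\to X_1\otimes X_2\to X_1$ (arrows delete the last factor) whose cone components $\pi_n:\bigotimes_{i\in\mathbb{N}} X_i\to X_1\otimes\cdots\otimes X_n$ are deterministic and which is preserved by $-\otimes Y$ for every object $Y$. A choice of Kolmogorov product is fixed for each sequence. Infinite parallel composite: for $(f_i:X_i\to Y_i)_{i\in\mathbb{N}}$ write $f_1^n=f_1\otimes\cdots\otimes f_n$. The endomorphisms $\mathrm{dom}(f_1^m\pi_m)$ of $\bigotimes_i X_i$ form a descending sequence in $m$, and the morphisms $f_1^n\,\pi_n\,\bigwedge_{m\in\mathbb{N}}\mathrm{dom}(f_1^m\pi_m):\bigotimes_i X_i\to Y_1\otimes\cdots\otimes Y_n$ form a cone over the diagram defining $\bigotimes_i Y_i$; $f_1^{\mathbb{N}}:\bigotimes_iX_i\to\bigotimes_iY_i$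 is the unique induced morphism, i.e. $\pi_n f_1^{\mathbb{N}}=f_1^n\,\pi_n\,\bigwedge_{m}\mathrm{dom}(f_1^m\pi_m)$ for all $n$. *)

(* Defs.v *)
From Stdlib Require Import FunctionalExtensionality.

Set Implicit Arguments.
Unset Strict Implicit.
Unset Printing Implicit Defensive.

Declare Scope cat_scope.
Delimit Scope cat_scope with cat.
Open Scope cat_scope.

Record category := Category {
  ob :> Type;
  hom : ob -> ob -> Type;
  idm : forall A : ob, hom A A;
  comp : forall A B D : ob, hom B D -> hom A B -> hom A D;
  comp_idl : forall (A B : ob) (f : hom A B), comp (idm B) f = f;
  comp_idr : forall (A B : ob) (f : hom A B), comp f (idm A) = f;
  comp_assoc : forall (A B D E : ob) (h : hom D E) (g : hom B D) (f : hom A B),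
    comp h (comp g f) = comp (comp h g) f
}.
Arguments hom {c} A B.
Arguments idm {c} A.
Arguments comp {c A B D} g f : rename.

Notation "g ∘ f" := (comp g f) (at level 40, left associativity) : cat_scope.

Record is_functor (C D : category) (F0 : C -> D)
    (F1 : forall A B : C, hom A B -> hom (F0 A) (F0 B)) : Prop := IsFunctor {
  fun_id : forall A : C, F1 A A (idm A) = idm (F0 A);
  fun_comp : forall (A B E : C) (g : hom B E) (f : hom A B),
    F1 A E (g ∘ f) = F1 B E g ∘ F1 A B f
}.

(* The countable power of C. *)
Definition sequence_category (C : category) : category.
Proof.
refine (@Category (nat -> C)
  (fun X Y => forall i, hom (X i) (Y i))
  (fun X i => idm (X i))
  (fun X Y Z g f i => g i ∘ f i) _ _ _).
- intros X Y f; apply functional_extensionality_dep; intro i; apply comp_idl.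
- intros X Y f; apply functional_extensionality_dep; intro i; apply comp_idr.
- intros X Y Z W h g f; apply functional_extensionality_dep; intro i;
  apply comp_assoc.
Defined.

(* Not assumed strict: associator, unitors and symmetry are explicit data. *)
Record smcategory := SMCategory {
  smcat :> category;
  tens : smcat -> smcat -> smcat;
  tensm : forall A B A' B' : smcat,
    hom A A' -> hom B B' -> hom (tens A B) (tens A' B');
  unit : smcat;
  assoc : forall A B D : smcat, hom (tens (tens A B) D) (tens A (tens B D));
  associnv : forall A B D : smcat, hom (tens A (tens B D)) (tens (tens A B) D);
  lunit : forall A : smcat, hom (tens unit A) A;
  lunitinv : forall A : smcat, hom A (tens unit A);
  runit : forall A : smcat, hom (tens A unit) A;
  runitinv : forall A : smcat, hom A (tens A unit);
  swap : forall A B : smcat, hom (tens A B) (tens B A);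
  tensm_id : forall A B : smcat, tensm (idm A) (idm B) = idm (tens A B);
  tensm_comp : forall (A B A' B' A'' B'' : smcat)
    (g : hom A' A'') (g' : hom B' B'') (f : hom A A') (f' : hom B B'),
    tensm (g ∘ f) (g' ∘ f') = tensm g g' ∘ tensm f f';
  assocK : forall A B D : smcat, associnv A B D ∘ assoc A B D = idm _;
  associnvK : forall A B D : smcat, assoc A B D ∘ associnv A B D = idm _;
  lunitK : forall A : smcat, lunitinv A ∘ lunit A = idm _;
  lunitinvK : forall A : smcat, lunit A ∘ lunitinv A = idm _;
  runitK : forall A : smcat, runitinv A ∘ runit A = idm _;
  runitinvK : forall A : smcat, runit A ∘ runitinv A = idm _;
  swapK : forall A B : smcat, swap B A ∘ swap A B = idm _;
  assoc_nat : forall (A B D A' B' D' : smcat)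
    (f : hom A A') (g : hom B B') (h : hom D D'),
    assoc A' B' D' ∘ tensm (tensm f g) h = tensm f (tensm g h) ∘ assoc A B D;
  lunit_nat : forall (A A' : smcat) (f : hom A A'),
    lunit A' ∘ tensm (idm unit) f = f ∘ lunit A;
  runit_nat : forall (A A' : smcat) (f : hom A A'),
    runit A' ∘ tensm f (idm unit) = f ∘ runit A;
  swap_nat : forall (A B A' B' : smcat) (f : hom A A') (g : hom B B'),
    swap A' B' ∘ tensm f g = tensm g f ∘ swap A B;
  pentagon : forall A B D E : smcat,
    assoc A B (tens D E) ∘ assoc (tens A B) D E
    = tensm (idm A) (assoc B D E) ∘ assoc A (tens B D) E
      ∘ tensm (assoc A B D) (idm E);
  triangle : forall A B : smcat,
    tensm (idm A) (lunit B) ∘ assoc A unit B = tensm (runit A) (idm B);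
  hexagon : forall A B D : smcat,
    assoc B D A ∘ swap A (tens B D) ∘ assoc A B D
    = tensm (idm B) (swap A D) ∘ assoc B A D ∘ tensm (swap A B) (idm D)
}.
Arguments tens {s} A B.
Arguments tensm {s A B A' B'} f g : rename.
Arguments unit {s}.
Arguments assoc {s} A B D.
Arguments associnv {s} A B D.
Arguments lunit {s} A.
Arguments lunitinv {s} A.
Arguments runit {s} A.
Arguments runitinv {s} A.
Arguments swap {s} A B.

Notation "A ⊗ B" := (tens A B) (at level 39, left associativity) : cat_scope.
Notation "f ⊠ g" := (tensm f g) (at level 39, left associativity) : cat_scope.

(* (A ⊗ B) ⊗ (D ⊗ E) → (A ⊗ D) ⊗ (B ⊗ E), the middle-four interchange. *)
Definition interchange (C : smcategory) (A B D E : C) :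
    hom ((A ⊗ B) ⊗ (D ⊗ E)) ((A ⊗ D) ⊗ (B ⊗ E)) :=
  associnv A D (B ⊗ E)
  ∘ (idm A ⊠ (assoc D B E ∘ (swap B D ⊠ idm E) ∘ associnv B D E))
  ∘ assoc A B (D ⊗ E).

(* Compatibility with the tensor product includes its nullary case, the unit. *)
Record cd_category := CDCategory {
  cdcat :> smcategory;
  copy : forall X : cdcat, hom X (X ⊗ X);
  del : forall X : cdcat, hom X unit;
  copy_assoc : forall X : cdcat,
    assoc X X X ∘ (copy X ⊠ idm X) ∘ copy X = (idm X ⊠ copy X) ∘ copy X;
  copy_dell : forall X : cdcat, lunit X ∘ (del X ⊠ idm X) ∘ copy X = idm X;
  copy_delr : forall X : cdcat, runit X ∘ (idm X ⊠ del X) ∘ copy X = idm X;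
  copy_swap : forall X : cdcat, swap X X ∘ copy X = copy X;
  copy_tens : forall X Y : cdcat,
    copy (X ⊗ Y) = interchange X X Y Y ∘ (copy X ⊠ copy Y);
  del_tens : forall X Y : cdcat, del (X ⊗ Y) = lunit unit ∘ (del X ⊠ del Y);
  copy_unit : copy unit = lunitinv unit;
  del_unit : del unit = idm unit
}.
Arguments copy {c} X.
Arguments del {c} X.

Section Morphisms.
Variable C : cd_category.

Definition total (A X : C) (f : hom A X) : Prop := del X ∘ f = del A.

Definition quasi_total (A X : C) (f : hom A X) : Prop :=
  f = runit X ∘ (f ⊠ (del X ∘ f)) ∘ copy A.

Definition copyable (A X : C) (f : hom A X) : Prop :=
  copy X ∘ f = (f ⊠ f) ∘ copy A.

Definition deterministic (A X : C) (f : hom A X) : Prop :=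
  total f /\ copyable f.

Definition dom (A X : C) (f : hom A X) : hom A A :=
  runit A ∘ (idm A ⊠ (del X ∘ f)) ∘ copy A.

Definition extends (A X : C) (f g : hom A X) : Prop := f ∘ dom g = g.

Definition descending (A X : C) (f : nat -> hom A X) : Prop :=
  forall n, extends (f n) (f (S n)).

(* m is a greatest lower bound of the f n, where [extends f g] reads f ⊒ g. *)
Definition is_meet (A X : C) (f : nat -> hom A X) (m : hom A X) : Prop :=
  (forall n, extends (f n) m) /\
  (forall h : hom A X, (forall n, extends (f n) h) -> extends m h).

End Morphisms.

Definition quasi_markov (C : cd_category) : Prop :=
  forall (A X : C) (f : hom A X), quasi_total f.

Definition positive (C : cd_category) : Prop :=
  forall (X Y Z : C) (f : hom X Y) (g : hom Y Z),
    copyable (g ∘ f) -> (idm Y ⊠ g) ∘ copy Y ∘ f = (f ⊠ (g ∘ f)) ∘ copy X.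

Record sigma_continuous (C : cd_category) : Prop := SigmaContinuous {
  meet_exists : forall (X Y : C) (f : nat -> hom X Y),
    descending f -> exists m : hom X Y, is_meet f m;
  meet_precomp : forall (W X Y : C) (f : nat -> hom X Y) (m : hom X Y)
    (g : hom W X),
    descending f -> is_meet f m -> is_meet (fun n => f n ∘ g) (m ∘ g);
  meet_postcomp : forall (X Y Z : C) (f : nat -> hom X Y) (m : hom X Y)
    (g : hom Y Z),
    descending f -> is_meet f m -> is_meet (fun n => g ∘ f n) (g ∘ m);
  meet_tensl : forall (X Y Z W : C) (f : nat -> hom X Y) (m : hom X Y)
    (g : hom Z W),
    descending f -> is_meet f m -> is_meet (fun n => g ⊠ f n) (g ⊠ m);
  meet_tensr : forall (X Y Z W : C) (f : nat -> hom X Y) (m : hom X Y)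
    (g : hom Z W),
    descending f -> is_meet f m -> is_meet (fun n => f n ⊠ g) (m ⊠ g)
}.

Definition is_cone (C : category) (D : nat -> C)
    (d : forall n, hom (D (S n)) (D n))
    (A : C) (q : forall n, hom A (D n)) : Prop :=
  forall n, d n ∘ q (S n) = q n.

Definition is_limit (C : category) (D : nat -> C)
    (d : forall n, hom (D (S n)) (D n))
    (L : C) (p : forall n, hom L (D n)) : Prop :=
  is_cone d p /\
  forall (A : C) (q : forall n, hom A (D n)), is_cone d q ->
    exists! u : hom A L, forall n, p n ∘ u = q n.

(* Sequences are indexed from 0: X 0, X 1, ... stand for X_1, X_2, ..., and
   index n of [ptens], [ptensm], [pdrop], [kp_proj] stands for the first
   n + 1 factors, so that the diagram starts with the single object X_1. *)
Fixpoint ptens (C : smcategory) (X : nat -> C) (n : nat) : C :=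
  match n with
  | 0 => X 0
  | S k => ptens X k ⊗ X (S k)
  end.

Fixpoint ptensm (C : smcategory) (X Y : nat -> C)
    (f : forall i, hom (X i) (Y i)) (n : nat) : hom (ptens X n) (ptens Y n) :=
  match n with
  | 0 => f 0
  | S k => ptensm f k ⊠ f (S k)
  end.

Definition pdrop (C : cd_category) (X : nat -> C) (n : nat) :
    hom (ptens X (S n)) (ptens X n) :=
  runit (ptens X n) ∘ (idm (ptens X n) ⊠ del (X (S n))).

Record kolmogorov_product (C : cd_category) (X : nat -> C) :=
    KolmogorovProduct {
  kp_ob : C;
  kp_proj : forall n, hom kp_ob (ptens X n);
  kp_det : forall n, deterministic (kp_proj n);
  kp_limit : is_limit (@pdrop C X) kp_proj;
  kp_preserved : forall Y : C,
    is_limit (D := fun n => ptens X n ⊗ Y)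
      (fun n => @pdrop C X n ⊠ idm Y) (fun n => kp_proj n ⊠ idm Y)
}.
Arguments kp_ob {C X} k.
Arguments kp_proj {C X} k n.

Definition is_infinite_parallel_composite (C : cd_category) (X Y : nat -> C)
    (KX : kolmogorov_product X) (KY : kolmogorov_product Y)
    (f : forall i, hom (X i) (Y i)) (h : hom (kp_ob KX) (kp_ob KY)) : Prop :=
  exists e : hom (kp_ob KX) (kp_ob KX),
    is_meet (fun m => dom (ptensm f m ∘ kp_proj KX m)) e /\
    forall n, kp_proj KY n ∘ h = ptensm f n ∘ kp_proj KX n ∘ e.
Arguments is_infinite_parallel_composite {C X Y} KX KY f h.

(* Main.v *)
Require Import Defs.
From Stdlib Require Import IndefiniteDescription.

Set Implicit Arguments.
Unset Strict Implicit.
Unset Printing Implicit Defensive.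

(** Why the proposition holds.  In a positive quasi-Markov category the
    assignment f ↦ dom f makes the category a restriction category: with partial
    functions in mind, dom f is the identity of A cut down to where f is
    defined, and
    - f ∘ dom f = f                               ([comp_dom]),
    - dom f ∘ dom g = dom g ∘ dom f               ([dom_commute]),
    - dom (g ∘ dom f) = dom g ∘ dom f             ([dom_comp_dom]),
    - dom g ∘ f = f ∘ dom (g ∘ f)                 ([dom_comp]).
    The first law is quasi-totality; the last one is positivity, applicable
    because quasi-totality makes every morphism into the unit copyable.

    Write f^n for the tensor product of the first factors, π_n for the
    projections and e_f for the meet of the dom (f^n ∘ π_n).  Restricting to
    the domain of u ⊠ v turns the projection of u ⊠ v into u after the
    projection ([pdrop_tensm]); hence the dom (f^n ∘ π_n) descend, and the
    f^n ∘ π_n ∘ e_f form a cone, which induces f^ℕ.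

    Identities are preserved since every dom (π_n) is an identity.  For
    composition, the restriction laws and f^ℕ ∘ e_f = f^ℕ give
    dom (g^n ∘ π_n) ∘ f^ℕ = f^ℕ ∘ dom (g^n ∘ f^n ∘ π_n ∘ e_f)
                          = f^ℕ ∘ e_f ∘ dom ((gf)^n ∘ π_n)
                          = f^ℕ ∘ dom ((gf)^n ∘ π_n),
    and σ-continuity passes to the meets: e_g ∘ f^ℕ = f^ℕ ∘ e_(gf).  Also
    e_f ∘ e_(gf) = e_(gf), as (gf)^n ∘ π_n is defined only where f^n ∘ π_n is
    ([domain_meet_comp]).  Therefore
    π_n ∘ g^ℕ ∘ f^ℕ = g^n ∘ π_n ∘ f^ℕ ∘ e_(gf)
                    = g^n ∘ f^n ∘ π_n ∘ e_f ∘ e_(gf) = (gf)^n ∘ π_n ∘ e_(gf),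
    which is the equation that characterises (gf)^ℕ. *)

(** * Coherence at the unit *)

Section UnitCoherence.
Context (C : cd_category).

(** Counitality of the comonoid on the unit yields this coherence without the
    pentagon: its comultiplication is [lunitinv unit] and its counit is the
    identity. *)
Lemma runit_unit : runit (unit : C) = lunit (unit : C).
Proof.
pose proof (copy_delr (unit : C)) as H.
rewrite del_unit, tensm_id, comp_idr, copy_unit in H.
rewrite <- (comp_idr (runit _)), <- (lunitK (unit : C)), comp_assoc, H.
apply comp_idl.
Qed.

(** This is the commutativity of the comonoid on the unit. *)
Lemma swap_unit : swap (unit : C) unit = idm (unit ⊗ unit).
Proof.
pose proof (copy_swap (unit : C)) as H; rewrite copy_unit in H.
rewrite <- (comp_idr (swap _ _)), <- (lunitK (unit : C)), comp_assoc, H.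
reflexivity.
Qed.

Lemma tensm_splitr (A B A' B' : C) (f : hom A A') (g : hom B B') :
  (f ⊠ idm B') ∘ (idm A ⊠ g) = f ⊠ g.
Proof. rewrite <- tensm_comp, comp_idl, comp_idr; reflexivity. Qed.

Lemma tensm_splitl (A B A' B' : C) (f : hom A A') (g : hom B B') :
  (idm A' ⊠ g) ∘ (f ⊠ idm B) = f ⊠ g.
Proof. rewrite <- tensm_comp, comp_idl, comp_idr; reflexivity. Qed.

End UnitCoherence.

(** * Restriction along morphisms into the unit *)

Section Restriction.
Context (C : cd_category).

(** [dom f] is [restrict (del X ∘ f)] by definition, and [del A ∘ _] recovers
    [p] from [restrict p] ([del_restrict]).  So domains on [A] correspond to
    morphisms from [A] into the unit, where the computations are easier. *)
Definition restrict (A : C) (p : hom A unit) : hom A A :=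
  runit A ∘ (idm A ⊠ p) ∘ copy A.

Lemma comp_restrict (A X : C) (f : hom A X) (p : hom A unit) :
  f ∘ restrict p = runit X ∘ (f ⊠ p) ∘ copy A.
Proof.
unfold restrict.
rewrite !comp_assoc, <- runit_nat, <- (comp_assoc (runit X)), tensm_splitr.
reflexivity.
Qed.

Lemma del_restrict (A : C) (p : hom A unit) : del A ∘ restrict p = p.
Proof.
rewrite comp_restrict, runit_unit, <- tensm_splitl, comp_assoc, lunit_nat.
rewrite <- !comp_assoc, (comp_assoc (lunit A)), copy_dell.
apply comp_idr.
Qed.

Lemma dom_restrict (A : C) (p : hom A unit) : dom (restrict p) = restrict p.
Proof. unfold dom; rewrite del_restrict; reflexivity. Qed.

Lemma restrict_effect_commute (A : C) (p q : hom A unit) :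
  p ∘ restrict q = q ∘ restrict p.
Proof.
rewrite !comp_restrict, <- (copy_swap A), comp_assoc.
rewrite <- (comp_assoc (runit _)), <- swap_nat, swap_unit, comp_idl.
rewrite (copy_swap A); reflexivity.
Qed.

End Restriction.

(** * The restriction laws *)

Section RestrictionLaws.
Context (C : cd_category) (hqm : quasi_markov C) (hpos : positive C).

Lemma comp_dom (A X : C) (f : hom A X) : f ∘ dom f = f.
Proof.
change (f ∘ restrict (del X ∘ f) = f).
rewrite comp_restrict; symmetry; apply hqm.
Qed.

Lemma restrict_idem (A : C) (p : hom A unit) :
  restrict p ∘ restrict p = restrict p.
Proof. rewrite <- (dom_restrict p) at 2; apply comp_dom. Qed.

(** On the unit, [copy] inverts the unitor and [del] is the identity, so
    quasi-totality of a morphism into the unit reads as copyability. *)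
Lemma copyable_effect (A : C) (p : hom A unit) : copyable p.
Proof.
unfold copyable; rewrite copy_unit, (hqm p) at 1.
rewrite del_unit, comp_idl, runit_unit, !comp_assoc, lunitK, comp_idl.
reflexivity.
Qed.

(** Positivity applies to any composite [p ∘ f] that ends in the unit. *)
Lemma restrict_comp (A X : C) (f : hom A X) (p : hom X unit) :
  restrict p ∘ f = f ∘ restrict (p ∘ f).
Proof.
rewrite comp_restrict; unfold restrict.
rewrite <- !comp_assoc, (comp_assoc (idm X ⊠ p)).
rewrite (hpos (copyable_effect (p ∘ f))); reflexivity.
Qed.

(** Written directly, this is coassociativity; the argument below avoids
    associators.  With r the right side, [restrict_comp] turns the left side
    into restrict q ∘ r and then into r ∘ restrict (q ∘ r).  Since q ∘ r is
    p ∘ restrict q, this is r ∘ r, which is r. *)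
Lemma restrict_restrict (A : C) (p q : hom A unit) :
  restrict p ∘ restrict q = restrict (p ∘ restrict q).
Proof.
rewrite restrict_comp, restrict_comp.
assert (H : q ∘ restrict (p ∘ restrict q) = p ∘ restrict q).
{ rewrite restrict_effect_commute, <- comp_assoc, restrict_idem; reflexivity. }
rewrite H; apply restrict_idem.
Qed.

Lemma dom_comp (A X Y : C) (f : hom A X) (g : hom X Y) :
  dom g ∘ f = f ∘ dom (g ∘ f).
Proof.
change (restrict (del Y ∘ g) ∘ f = f ∘ restrict (del Y ∘ (g ∘ f))).
rewrite restrict_comp, comp_assoc; reflexivity.
Qed.

Lemma dom_comp_dom (A X Y : C) (g : hom A Y) (h : hom A X) :
  dom (g ∘ dom h) = dom g ∘ dom h.
Proof.
change (restrict (del Y ∘ (g ∘ restrict (del X ∘ h)))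
        = restrict (del Y ∘ g) ∘ restrict (del X ∘ h)).
rewrite restrict_restrict, comp_assoc; reflexivity.
Qed.

Lemma dom_commute (A X Y : C) (f : hom A X) (g : hom A Y) :
  dom f ∘ dom g = dom g ∘ dom f.
Proof.
change (restrict (del X ∘ f) ∘ restrict (del Y ∘ g)
        = restrict (del Y ∘ g) ∘ restrict (del X ∘ f)).
rewrite !restrict_restrict, restrict_effect_commute; reflexivity.
Qed.

Lemma dom_dom (A X : C) (f : hom A X) : dom (dom f) = dom f.
Proof. apply dom_restrict. Qed.

Lemma dom_total_comp (A X Y : C) (g : hom X Y) (f : hom A X) :
  total g -> dom (g ∘ f) = dom f.
Proof. intro H; unfold dom; rewrite comp_assoc, H; reflexivity. Qed.

Lemma dom_total (A X : C) (f : hom A X) : total f -> dom f = idm A.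
Proof. intro H; unfold dom; rewrite H; apply copy_delr. Qed.

Lemma dom_comp_absorb (A X Y : C) (g : hom X Y) (f : hom A X) :
  dom f ∘ dom (g ∘ f) = dom (g ∘ f).
Proof.
rewrite dom_commute, <- dom_comp_dom, <- comp_assoc, comp_dom; reflexivity.
Qed.

Lemma is_meet_unique (A X : C) (f : nat -> hom A X) (m m' : hom A X) :
  is_meet f m -> is_meet f m' -> m = m'.
Proof.
intros [lb glb] [lb' glb'].
pose proof (glb _ lb') as H; pose proof (glb' _ lb) as H'.
unfold extends in H, H'.
rewrite <- H', <- H, <- comp_assoc, dom_commute, comp_assoc, comp_dom, H.
reflexivity.
Qed.

End RestrictionLaws.

(** * Deleting a factor *)

Definition drop_right (C : cd_category) (A B : C) : hom (A ⊗ B) A :=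
  runit A ∘ (idm A ⊠ del B).

Section Dropping.
Context (C : cd_category) (hqm : quasi_markov C) (hpos : positive C)
  (hsig : sigma_continuous C).

Lemma total_drop_right (A B : C) : total (drop_right A B).
Proof.
unfold total, drop_right.
rewrite comp_assoc, <- runit_nat, <- comp_assoc, tensm_splitr, runit_unit.
symmetry; apply del_tens.
Qed.

Lemma is_meet_dom (A X : C) (f : hom A X) :
  let d := fun n => match n with 0 => idm A | S _ => dom f end in
  descending d /\ is_meet d (dom f).
Proof.
intro d.
assert (H : forall n, extends (d n) (dom f)).
{ intros [|n]; unfold extends; simpl; [rewrite comp_idl; apply dom_dom|].
  apply comp_dom, hqm. }
split; [intro n; apply H|split; [exact H|]].
intros h Hh; exact (Hh 1).
Qed.

(** Tensoring preserves the meet of the descending sequence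
    id ⊒ dom f ⊒ dom f ⊒ ..., so in particular it preserves the inequality
    id ⊒ dom f. *)
Lemma dom_tensl_dom (Z A X : C) (f : hom A X) :
  dom (idm Z ⊠ dom f) = idm Z ⊠ dom f.
Proof.
destruct (is_meet_dom f) as [Hd Hm].
destruct (meet_tensl hsig (idm Z) Hd Hm) as [lb _].
specialize (lb 0); unfold extends in lb; simpl in lb.
rewrite tensm_id, comp_idl in lb; exact lb.
Qed.

(** Dropping the output of [v] still leaves its domain behind, as the factor
    [idm A ⊠ dom v].  This factor may be shrunk to [dom (u ⊠ v)], because
    [u ⊠ v] precedes the projection on the left side. *)
Lemma drop_right_tensm (A B A' B' : C) (u : hom A A') (v : hom B B') :
  drop_right A' B' ∘ (u ⊠ v) = u ∘ drop_right A B ∘ dom (u ⊠ v).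
Proof.
set (d := idm A ⊠ dom v).
assert (Hd : dom d = d) by apply dom_tensl_dom.
assert (Hw : (u ⊠ v) ∘ d = u ⊠ v).
{ unfold d; rewrite <- tensm_comp, comp_idr, (comp_dom hqm); reflexivity. }
assert (Hp : drop_right A' B' ∘ (u ⊠ v) = u ∘ drop_right A B ∘ d).
{ unfold drop_right, d.
  rewrite <- !comp_assoc, <- tensm_comp, comp_idl, <- tensm_comp, comp_idl.
  change (dom v) with (restrict (del B' ∘ v)); rewrite del_restrict.
  rewrite comp_assoc, <- runit_nat, <- comp_assoc, tensm_splitr; reflexivity. }
assert (Hdw : d ∘ dom (u ⊠ v) = dom (u ⊠ v)).
{ rewrite <- Hw at 2; rewrite <- Hd at 2.
  rewrite dom_comp_dom, Hd by assumption.
  rewrite <- Hd at 1; rewrite dom_commute by assumption; rewrite Hd; reflexivity. }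
rewrite <- Hdw, comp_assoc, <- Hp, <- comp_assoc, (comp_dom hqm).
reflexivity.
Qed.

End Dropping.

(** * Infinite parallel composites *)

Lemma ptensm_id (C : smcategory) (X : nat -> C) (n : nat) :
  ptensm (fun i => idm (X i)) n = idm (ptens X n).
Proof.
induction n as [|n IH]; simpl; [reflexivity|].
rewrite IH; apply tensm_id.
Qed.

Lemma ptensm_comp (C : smcategory) (X Y Z : nat -> C)
    (g : forall i, hom (Y i) (Z i)) (f : forall i, hom (X i) (Y i)) (n : nat) :
  ptensm (fun i => g i ∘ f i) n = ptensm g n ∘ ptensm f n.
Proof.
induction n as [|n IH]; simpl; [reflexivity|].
rewrite IH; apply tensm_comp.
Qed.

Lemma limit_ext (C : category) (D : nat -> C)
    (d : forall n, hom (D (S n)) (D n)) (L : C) (p : forall n, hom L (D n))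
    (A : C) (u v : hom A L) :
  is_limit d p -> (forall n, p n ∘ u = p n ∘ v) -> u = v.
Proof.
intros [Hc Hl] H.
destruct (Hl A (fun n => p n ∘ v)) as [w [_ Hw]].
{ intro n; rewrite comp_assoc, Hc; reflexivity. }
rewrite <- (Hw u H); apply Hw; reflexivity.
Qed.

Section Composite.
Context (C : cd_category) (hqm : quasi_markov C) (hpos : positive C)
  (hsig : sigma_continuous C).

Definition domains (X Y : nat -> C) (KX : kolmogorov_product X)
    (f : forall i, hom (X i) (Y i)) (m : nat) : hom (kp_ob KX) (kp_ob KX) :=
  dom (ptensm f m ∘ kp_proj KX m).

Lemma pdrop_tensm (X Y : nat -> C) (KX : kolmogorov_product X)
    (f : forall i, hom (X i) (Y i)) (n : nat) :
  pdrop Y n ∘ (ptensm f (S n) ∘ kp_proj KX (S n))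
  = ptensm f n ∘ kp_proj KX n ∘ domains KX f (S n).
Proof.
assert (H : pdrop Y n ∘ ptensm f (S n)
            = ptensm f n ∘ pdrop X n ∘ dom (ptensm f (S n)))
  by apply (drop_right_tensm hqm hpos hsig).
unfold domains; rewrite comp_assoc, H, <- comp_assoc, dom_comp by assumption.
rewrite comp_assoc, <- (comp_assoc (ptensm f n)).
rewrite (proj1 (kp_limit KX) n); reflexivity.
Qed.

Lemma descending_domains (X Y : nat -> C) (KX : kolmogorov_product X)
    (f : forall i, hom (X i) (Y i)) :
  descending (domains KX f).
Proof.
intro n; unfold extends.
unfold domains at 2; rewrite dom_dom.
unfold domains at 1; rewrite <- dom_comp_dom by assumption.
change (dom (ptensm f (S n) ∘ kp_proj KX (S n))) with (domains KX f (S n)).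
rewrite <- pdrop_tensm.
apply dom_total_comp, total_drop_right.
Qed.

Lemma dom_meet_domains (X Y : nat -> C) (KX : kolmogorov_product X)
    (f : forall i, hom (X i) (Y i)) (e : hom (kp_ob KX) (kp_ob KX)) :
  is_meet (domains KX f) e ->
  dom e = e /\ forall n, domains KX f n ∘ e = e.
Proof.
intros [lb _].
assert (He : dom e = e).
{ pose proof (lb 0) as H0; unfold extends, domains in H0.
  rewrite <- H0 at 1; rewrite dom_comp_dom, dom_dom by assumption; exact H0. }
split; [exact He|].
intro n; rewrite <- He at 1; apply lb.
Qed.

Lemma composite_exists_unique (X Y : nat -> C) (KX : kolmogorov_product X)
    (KY : kolmogorov_product Y) (f : forall i, hom (X i) (Y i)) :
  exists h, unique (is_infinite_parallel_composite KX KY f) h.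
Proof.
destruct (meet_exists hsig (descending_domains KX f)) as [e He].
destruct (dom_meet_domains He) as [_ Hfix].
destruct (proj2 (kp_limit KY) (kp_ob KX)
            (fun n => ptensm f n ∘ kp_proj KX n ∘ e)) as [h [Hh Huniq]].
{ intro n.
  rewrite comp_assoc, pdrop_tensm, <- comp_assoc, Hfix; reflexivity. }
exists h; split; [exists e; split; assumption|].
intros h' [e' [He' Hh']]; apply Huniq; intro n.
rewrite (is_meet_unique hqm hpos He He'); apply Hh'.
Qed.

Lemma composite_id (X : nat -> C) (KX : kolmogorov_product X) :
  is_infinite_parallel_composite KX KX (fun i => idm (X i)) (idm (kp_ob KX)).
Proof.
exists (idm (kp_ob KX)).
assert (Hdom : forall m,
  dom (ptensm (fun i => idm (X i)) m ∘ kp_proj KX m) = idm (kp_ob KX)).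
{ intro m; rewrite ptensm_id, comp_idl; apply dom_total, kp_det. }
split; [split|].
- intro m; rewrite Hdom; apply comp_dom, hqm.
- intros h Hh; specialize (Hh 0); rewrite Hdom in Hh; exact Hh.
- intro n; rewrite ptensm_id, comp_idl; reflexivity.
Qed.

(** As [h] is already restricted to [ef], the domain of g^n pulls back along
    [h] to the domain of (gf)^n; the second equation is the meet of these
    pullbacks over n. *)
Lemma domain_meet_comp (X Y Z : nat -> C) (KX : kolmogorov_product X)
    (KY : kolmogorov_product Y)
    (f : forall i, hom (X i) (Y i)) (g : forall i, hom (Y i) (Z i))
    (h : hom (kp_ob KX) (kp_ob KY))
    (ef egf : hom (kp_ob KX) (kp_ob KX)) (eg : hom (kp_ob KY) (kp_ob KY)) :
  is_meet (domains KX f) ef ->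
  is_meet (domains KX (fun i => g i ∘ f i)) egf ->
  is_meet (domains KY g) eg ->
  (forall n, kp_proj KY n ∘ h = ptensm f n ∘ kp_proj KX n ∘ ef) ->
  ef ∘ egf = egf /\ eg ∘ h = h ∘ egf.
Proof.
intros Hf Hgf Hg Hh.
destruct (dom_meet_domains Hf) as [Hef _].
destruct (dom_meet_domains Hgf) as [Hegf fix_gf].
assert (Habs : ef ∘ egf = egf).
{ rewrite <- Hegf at 1; apply Hf; intro n; unfold extends; rewrite Hegf.
  rewrite <- (fix_gf n), comp_assoc; f_equal; unfold domains.
  rewrite ptensm_comp, <- comp_assoc; apply dom_comp_absorb; assumption. }
split; [exact Habs|].
assert (Hhef : h ∘ ef = h).
{ apply (limit_ext (kp_limit KY)); intro n.
  rewrite comp_assoc, Hh, <- comp_assoc.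
  rewrite <- Hef at 2; rewrite (comp_dom hqm); reflexivity. }
assert (Hdom : forall m, domains KY g m ∘ h
                         = h ∘ domains KX (fun i => g i ∘ f i) m).
{ intro m; unfold domains; rewrite dom_comp by assumption.
  rewrite <- comp_assoc, Hh, <- Hef, !comp_assoc, dom_comp_dom by assumption.
  rewrite dom_commute, Hef, comp_assoc, Hhef by assumption.
  rewrite ptensm_comp; reflexivity. }
pose proof (meet_precomp hsig h (descending_domains KY g) Hg) as Hl.
pose proof (meet_postcomp hsig h
  (descending_domains KX (fun i => g i ∘ f i)) Hgf) as Hr.
apply (is_meet_unique hqm hpos Hl).
destruct Hr as [lb glb]; split.
- intro m; rewrite Hdom; apply lb.
- intros k Hk; apply glb; intro m; rewrite <- Hdom; apply Hk.
Qed.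

Lemma composite_comp (X Y Z : nat -> C) (KX : kolmogorov_product X)
    (KY : kolmogorov_product Y) (KZ : kolmogorov_product Z)
    (f : forall i, hom (X i) (Y i)) (g : forall i, hom (Y i) (Z i))
    (h : hom (kp_ob KX) (kp_ob KY)) (k : hom (kp_ob KY) (kp_ob KZ)) :
  is_infinite_parallel_composite KX KY f h ->
  is_infinite_parallel_composite KY KZ g k ->
  is_infinite_parallel_composite KX KZ (fun i => g i ∘ f i) (k ∘ h).
Proof.
intros [ef [Hf Hh]] [eg [Hg Hk]].
destruct (meet_exists hsig
  (descending_domains KX (fun i => g i ∘ f i))) as [egf Hgf].
destruct (domain_meet_comp Hf Hgf Hg Hh) as [Habs Hswap].
exists egf; split; [exact Hgf|]; intro n.
rewrite comp_assoc, Hk, <- comp_assoc, Hswap.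
rewrite comp_assoc, <- (comp_assoc (ptensm g n)), Hh, <- !comp_assoc, Habs.
rewrite ptensm_comp, <- !comp_assoc; reflexivity.
Qed.

End Composite.

Theorem proposition2p30 (C : cd_category) (hqm : quasi_markov C)
    (hpos : positive C) (hsig : sigma_continuous C)
    (K : forall X : nat -> C, kolmogorov_product X) :
  exists F : forall X Y : sequence_category C,
      hom X Y -> hom (kp_ob (K X)) (kp_ob (K Y)),
    (forall (X Y : sequence_category C) (f : hom X Y),
      unique (is_infinite_parallel_composite (K X) (K Y) f) (F X Y f)) /\
    is_functor (C := sequence_category C) (D := C) (F0 := fun X => kp_ob (K X)) F.
Proof.
pose (choice X Y f := constructive_indefinite_description _
  (composite_exists_unique hqm hpos hsig (K X) (K Y) f)).
exists (fun X Y f => proj1_sig (choice X Y f)).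
assert (HF : forall X Y f, unique
  (is_infinite_parallel_composite (K X) (K Y) f) (proj1_sig (choice X Y f))).
{ intros X Y f; exact (proj2_sig (choice X Y f)). }
split; [exact HF|split].
- intro X; apply HF, composite_id; assumption.
- intros X Y Z g f; apply HF, composite_comp; try assumption; apply HF.
Qed.
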